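(* Let $p>3$ be a prime with $\left(\frac{p}{19}\right)=-1$. Then $$\sum_{k=0}^{p-1}\frac{\binom{2k}{k}\binom{3k}{k}\binom{6k}{3k}}{(-96)^{3k}}\equiv 0\pmod{p^2}.$$
   Context: $\left(\frac{a}{m}\right)$ denotes the Jacobi symbol. Congruences modulo $p^2$ are taken in the ring $\mathbb{Z}_p$ of rational numbers whose denominator is coprime to $p$: for $u,v$ in this ring, $u\equiv v\pmod{p^2}$ means $(u-v)/p^2$ lies in this ring. *)

(* Defs.v *)
From mathcomp Require Import all_boot all_order all_algebra.

Set Implicit Arguments.
Unset Strict Implicit.
Unset Printing Implicit Defensive.

Import Order.TTheory GRing.Theory Num.Theory.
Local Open Scope ring_scope.

(* Meaningful for q an odd prime. *)
Definition legendre (a : int) (q : nat) : int :=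
  if (q%:Z %| a)%Z then 0
  else if [exists x : 'I_q, (x%:Z ^+ 2 == a %[mod q%:Z])%Z] then 1
  else -1.

(* Meaningful for m odd and positive; 'primes m' lists each prime divisor
   once, hence the exponent. *)
Definition jacobi (a : int) (m : nat) : int :=
  \prod_(q <- primes m) legendre a q ^+ logn q m.

(* 'denq' is the positive denominator in lowest terms. *)
Definition p_integral (p : nat) : {pred rat} :=
  [pred x : rat | coprime `|denq x| p].

Definition p_congr (p n : nat) (u v : rat) : bool :=
  [&& u \in p_integral p, v \in p_integral p
    & (u - v) / p%:R ^+ n \in p_integral p].

(* Main.v *)
Require Import Defs.
From HB Require Import structures.
From mathcomp Require Import all_boot all_order all_algebra all_field.
From mathcomp Require Import ring zify.
Import Order.TTheory GRing.Theory Num.Theory.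
Local Open Scope ring_scope.
Set Implicit Arguments.
Unset Strict Implicit.
Unset Printing Implicit Defensive.

(** The sum is the truncation at degree p-1 of the hypergeometric series
    3F2(1/6, 1/2, 5/6; 1, 1; 1728 z) at z = 1/j, where j = (-96)^3 is the
    j-invariant of the elliptic curves with complex multiplication by the
    ring Z[(1 + sqrt(-19))/2].

    By Clausen's identity, the 3F2 series at z = t (1 - 432 t) is the square
    of the series with coefficients C(3k,k) C(6k,3k) at t.  The truncations
    still satisfy this modulo p^2 ([clausen_mod]): below degree p both sides
    are determined by the same third order differential equation, and from
    degree p on both have all their coefficients divisible by p^2.  It is
    therefore enough that the truncated 2F1 series vanish modulo p at the two
    roots t of t (1 - 432 t) = z, because the square of a multiple of p is a
    multiple of p^2.

    Modulo p, the truncated 2F1 series at t is the Hasse invariant of the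
    curve y^2 = 4 x^3 + x^2 - 4 t, namely the coefficient of x^(p-1) in the
    ((p-1)/2)-th power of the right hand side ([hasse_cubic]).  This curve has
    j-invariant 1/(t (1 - 432 t)) = (-96)^3, so an affine change of variable
    turns it into y^2 = x^3 - 152 x + 722 ([hasse_cubic_cm19]).  The latter has an
    explicit endomorphism of degree 5 that multiplies the differential dx/y by
    a root a of a^2 - a + 5 ([iso_curve], [iso_differential]).  Since the
    Cartier operator is p^(-1)-linear and commutes with pullbacks, the Hasse
    invariant A satisfies a^p A = a A ([hasse_isogeny0]).  Finally -a can be
    taken to be a Gaussian period of the 19th roots of unity, and the Frobenius
    map moves it exactly when p is not a square modulo 19
    ([gauss_period19]); hence A = 0.

    The roots t are (1 - w)/864 with w^2 = 513/512, and w need not exist over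
    Z/p^2.  Splitting the truncated series into its even and odd parts in w
    replaces t by rational data: both parts vanish modulo p at 513/512, and
    Clausen's identity writes the sum as a combination of their squares
    ([f32_sum_eq0]). *)

(** * General facts on polynomials *)

Lemma polyC_natE (R : nzRingType) k : k%:R = (k%:R)%:P :> {poly R}.
Proof. by rewrite polyC_natr. Qed.

Lemma deriv_natr (R : nzRingType) k : (k%:R : {poly R})^`() = 0.
Proof. by rewrite polyC_natE derivC. Qed.

Lemma comp_poly_natr (R : comNzRingType) k (F : {poly R}) : k%:R \Po F = k%:R.
Proof. by rewrite polyC_natE comp_polyC. Qed.

Lemma comp_poly1 (R : comNzRingType) (F : {poly R}) : 1 \Po F = 1.
Proof. exact: comp_polyC. Qed.

Lemma even_poly_compX2 (R : nzRingType) (F : {poly R}) : even_poly (F \Po 'X^2) = F.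
Proof.
apply/polyP => i; rewrite coef_even_poly coef_comp_poly_Xn // -muln2.
by rewrite dvdn_mull // mulnK.
Qed.

Lemma odd_poly_compX2 (R : nzRingType) (F : {poly R}) : odd_poly (F \Po 'X^2) = 0.
Proof.
apply/polyP => i; rewrite coef_odd_poly coef_comp_poly_Xn // coef0 ifF //.
by rewrite dvdn2 /= odd_double.
Qed.

Lemma even_poly_square (R : comNzRingType) (F : {poly R}) :
  even_poly (F ^+ 2) = even_poly F ^+ 2 + odd_poly F ^+ 2 * 'X.
Proof.
set A := even_poly F; set B := odd_poly F.
have -> : F ^+ 2 = ((A ^+ 2 + B ^+ 2 * 'X) \Po 'X^2) + ((2 * A * B) \Po 'X^2) * 'X.
  rewrite -{1}[F]poly_even_odd -/A -/B comp_polyD !comp_polyM !comp_polyX.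
  rewrite comp_poly_natr.
  by rewrite !expr2; ring.
by rewrite even_polyD even_polyMX even_poly_compX2 odd_poly_compX2 mul0r addr0.
Qed.

Lemma map_even_poly (R S : nzRingType) (f : {rmorphism R -> S}) (F : {poly R}) :
  map_poly f (even_poly F) = even_poly (map_poly f F).
Proof. by apply/polyP => i; rewrite !(coef_map, coef_even_poly). Qed.

Lemma map_odd_poly (R S : nzRingType) (f : {rmorphism R -> S}) (F : {poly R}) :
  map_poly f (odd_poly F) = odd_poly (map_poly f F).
Proof. by apply/polyP => i; rewrite !(coef_map, coef_odd_poly). Qed.

Lemma map_comp_affine (R S : comNzRingType) (f : {rmorphism R -> S}) (F : {poly R}) u :
  map_poly f (F \Po (u *: (1 - 'X))) = map_poly f F \Po (f u *: (1 - 'X)).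
Proof. by rewrite map_comp_poly map_polyZ rmorphB rmorph1 /= map_polyX. Qed.

(** * The hypergeometric coefficients *)

(** The Taylor coefficients of 2F1(1/6, 5/6; 1; 432 x). *)
Definition f21_coef k := ('C(3 * k, k) * 'C(6 * k, 3 * k))%N.

(** The Taylor coefficients of 3F2(1/6, 1/2, 5/6; 1, 1; 1728 z). *)
Definition f32_coef k := ('C(2 * k, k) * 'C(3 * k, k) * 'C(6 * k, 3 * k))%N.

Lemma f21_coefE k : (f21_coef k * ((3 * k)`! * ((2 * k)`! * k`!)) = (6 * k)`!)%N.
Proof.
have h3 := @bin_fact (3 * k) k ltac:(lia).
have h6 := @bin_fact (6 * k) (3 * k) ltac:(lia).
rewrite -h6 (_ : 6 * k - 3 * k = 3 * k)%N -?[in LHS]/(f21_coef k); last by lia.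
rewrite (_ : 3 * k - k = 2 * k)%N in h3; last by lia.
rewrite /f21_coef -{3}h3; ring.
Qed.

Lemma f32_coefE k : (f32_coef k * ((3 * k)`! * (k`! * k`! * k`!)) = (6 * k)`!)%N.
Proof.
have h2 := @bin_fact (2 * k) k ltac:(lia).
rewrite (_ : 2 * k - k = k)%N in h2; last by lia.
by rewrite -f21_coefE -h2 /f32_coef /f21_coef; ring.
Qed.

Lemma f21_coef_rec k :
  ((k.+1 ^ 2) * f21_coef k.+1 = 12 * (6 * k + 1) * (6 * k + 5) * f21_coef k)%N.
Proof.
have h0 := f21_coefE k; have h1 := f21_coefE k.+1.
have f6 : ((6 * k.+1)`! = (6 * k + 6) * (6 * k + 5) * (6 * k + 4) * (6 * k + 3)
    * (6 * k + 2) * (6 * k + 1) * (6 * k)`!)%N.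
  by rewrite (_ : 6 * k.+1 = (6 * k).+1.+1.+1.+1.+1.+1)%N ?factS; lia.
have f3 : ((3 * k.+1)`! = (3 * k + 3) * (3 * k + 2) * (3 * k + 1) * (3 * k)`!)%N.
  by rewrite (_ : 3 * k.+1 = (3 * k).+1.+1.+1)%N ?factS; lia.
have f2 : ((2 * k.+1)`! = (2 * k + 2) * (2 * k + 1) * (2 * k)`!)%N.
  by rewrite (_ : 2 * k.+1 = (2 * k).+1.+1)%N ?factS; lia.
set d := (((3 * k)`! * ((2 * k)`! * k`!))
  * ((3 * k + 3) * (3 * k + 2) * (3 * k + 1) * 2 * (2 * k + 1)))%N.
have d0 : (0 < d)%N by rewrite !muln_gt0 !fact_gt0; lia.
apply/eqP; rewrite -(eqn_pmul2r d0); apply/eqP.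
move: h1; rewrite f6 f3 f2 factS -h0 /d => h1.
apply: etrans (etrans h1 _); ring.
Qed.

Lemma central_bin_rec k :
  (k.+1 * 'C(2 * k.+1, k.+1) = 2 * (2 * k + 1) * 'C(2 * k, k))%N.
Proof.
have h0 := @bin_fact (2 * k) k ltac:(lia).
have h1 := @bin_fact (2 * k.+1) k.+1 ltac:(lia).
rewrite (_ : 2 * k - k = k)%N in h0; last by lia.
rewrite (_ : 2 * k.+1 - k.+1 = k.+1)%N in h1; last by lia.
rewrite [in RHS](_ : 2 * k.+1 = (2 * k).+1.+1)%N in h1; last by lia.
rewrite !factS -h0 in h1.
have d0 : (0 < k.+1 * (k`! * k`!))%N by rewrite !muln_gt0 !fact_gt0.
apply/eqP; rewrite -(eqn_pmul2r d0); apply/eqP.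
transitivity ('C(2 * k.+1, k.+1) * (k.+1 * k`! * (k.+1 * k`!)))%N; first by ring.
by rewrite h1; ring.
Qed.

Lemma f32_coef_rec k :
  (k.+1 ^ 3 * f32_coef k.+1 =
   24 * (2 * k + 1) * (6 * k + 1) * (6 * k + 5) * f32_coef k)%N.
Proof.
have fE j : f32_coef j = ('C(2 * j, j) * f21_coef j)%N by rewrite /f32_coef -mulnA.
rewrite !fE.
transitivity (k.+1 * 'C(2 * k.+1, k.+1) * (k.+1 ^ 2 * f21_coef k.+1))%N; first by ring.
by rewrite central_bin_rec f21_coef_rec; ring.
Qed.

Lemma prime_dvd_fact p k : prime p -> (p %| k`!)%N = (p <= k)%N.
Proof.
move=> p_pr; elim: k => [|k IHk].
  by rewrite fact0 dvdn1 leqn0; case: p p_pr => [|[]].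
rewrite factS Euclid_dvdM // IHk (leq_eqVlt p k.+1) ltnS orbC.
have [->|] := eqVneq p k.+1; first by rewrite dvdnn !orbT.
move=> neq; have [|ltkp] := leqP p k; first by rewrite orbT.
rewrite orbF; apply/negbTE/negP => /dvdn_leq; lia.
Qed.

Lemma logn_fact_lt p m : prime p -> (m < p ^ 2)%N -> logn p m`! = (m %/ p)%N.
Proof.
move=> p_pr ltm; rewrite logn_fact //.
case: m ltm => [|m] ltm; first by rewrite big_geq // div0n.
rewrite big_nat_recl // big_nat_cond big1 ?addn0 ?expn1 // => i /andP[/andP[i1 _] _].
by rewrite divn_small // (leq_trans ltm) // leq_exp2l // prime_gt1.
Qed.

Section Valuation.
Variables (p : nat) (p_pr : prime p) (p_gt5 : (5 < p)%N).

(** Legendre's formula for the factorials in [f21_coefE]; as 6k < p^2, each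
    valuation is a single quotient by p. *)
Lemma dvdn_f21_coef e k : (k < p)%N ->
  ((3 * k) %/ p + (2 * k) %/ p + e <= (6 * k) %/ p)%N -> (p ^ e %| f21_coef k)%N.
Proof.
move=> ltkp le_e; have p0 := prime_gt0 p_pr.
have c0 : (0 < f21_coef k)%N by rewrite muln_gt0 !bin_gt0; lia.
move: (f21_coef k) c0 (f21_coefE k) => c c0 /(congr1 (logn p)) cE.
rewrite pfactor_dvdn //.
have lt6 : (6 * k < p ^ 2)%N by rewrite -mulnn; nia.
move: cE; rewrite !lognM ?muln_gt0 ?fact_gt0 // !logn_fact_lt ?(divn_small ltkp); lia.
Qed.

Lemma dvdn_f32_coef e k : (k < p)%N ->
  ((3 * k) %/ p + e <= (6 * k) %/ p)%N -> (p ^ e %| f32_coef k)%N.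
Proof.
move=> ltkp le_e; have p0 := prime_gt0 p_pr.
have c0 : (0 < f32_coef k)%N by rewrite !muln_gt0 !bin_gt0; lia.
move: (f32_coef k) c0 (f32_coefE k) => c c0 /(congr1 (logn p)) cE.
rewrite pfactor_dvdn //.
have lt6 : (6 * k < p ^ 2)%N by rewrite -mulnn; nia.
move: cE; rewrite !lognM ?muln_gt0 ?fact_gt0 // !logn_fact_lt ?(divn_small ltkp); lia.
Qed.

Lemma divn_bounds m : (m %/ p * p <= m < (m %/ p).+1 * p)%N.
Proof. by rewrite leq_divM -ltn_divLR ?ltnSn ?prime_gt0. Qed.

Lemma dvdp_f21_coef k : (p <= 6 * k)%N -> (k < p)%N -> (p %| f21_coef k)%N.
Proof.
move=> le6 ltk; rewrite -[p]expn1; apply: dvdn_f21_coef => //.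
rewrite leq_divRL ?prime_gt0 //.
have := divn_bounds (3 * k); have := divn_bounds (2 * k).
case: (_ %/ _)%N => [|[|y]]; case: (_ %/ _)%N => [|[|[|x]]]; rewrite ?mulSn; nia.
Qed.

Lemma dvdp2_f21_coef k : (5 * p <= 6 * k)%N -> (k < p)%N -> (p ^ 2 %| f21_coef k)%N.
Proof.
move=> le6 ltk; apply: dvdn_f21_coef => //; rewrite leq_divRL ?prime_gt0 //.
have := divn_bounds (3 * k); have := divn_bounds (2 * k).
case: (_ %/ _)%N => [|[|y]]; case: (_ %/ _)%N => [|[|[|x]]]; rewrite ?mulSn; nia.
Qed.

Lemma dvdp2_f32_coef k : (p <= 2 * k)%N -> (k < p)%N -> (p ^ 2 %| f32_coef k)%N.
Proof.
move=> le2 ltk; apply: dvdn_f32_coef => //; rewrite leq_divRL ?prime_gt0 //.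
have := divn_bounds (3 * k).
case: (_ %/ _)%N => [|[|[|x]]]; rewrite ?mulSn; nia.
Qed.

End Valuation.

(** * Clausen's identity for the truncated series *)

Section ODE.
Variable R : comNzRingType.
Implicit Types F Y S : {poly R}.

Definition quad : {poly R} := 'X - 432 * 'X^2.

Definition dquad : {poly R} := 1 - 864 * 'X.

Lemma deriv_quad : quad^`() = dquad.
Proof.
rewrite /quad /dquad derivB derivM derivX derivXn deriv_natr /=; ring.
Qed.

Lemma deriv_dquad : dquad^`() = - 864.
Proof.
rewrite /dquad derivB derivM derivX -[1]/(1%:R) !deriv_natr; ring.
Qed.

(** The Gauss operator that annihilates 2F1(1/6, 5/6; 1; 432 x). *)
Definition hg21_op Y := quad * Y^`()^`() + dquad * Y^`() - 60 * Y.

(** The operator that annihilates 3F2(1/6, 1/2, 5/6; 1, 1; 1728 z). *)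
Definition hg32_op F := 'X^2 * (1 - 1728 * 'X) * F^`()^`()^`()
  + 3 * 'X * (1 - 2592 * 'X) * F^`()^`() + (1 - 12 * 452 * 'X) * F^`() - 120 * F.

(** The symmetric square of [hg21_op]: it annihilates the products of two
    solutions of [hg21_op]. *)
Definition sym2_op F := quad ^+ 2 * F^`()^`()^`() + 3 * quad * dquad * F^`()^`()
  + (1 - 2832 * quad) * F^`() - 120 * dquad * F.

(** This is why [sym2_op] is the symmetric square of [hg21_op]; written with the
    defect of [hg21_op], it also applies to truncated series, which solve the
    equation only up to a term of top degree. *)
Lemma sym2_op_square Y :
  sym2_op (Y ^+ 2) = 2 * quad * Y * (hg21_op Y)^`()
    + (6 * quad * Y^`() + 2 * dquad * Y) * hg21_op Y.
Proof.
have dE : (hg21_op Y)^`() = quad * Y^`()^`()^`() + 2 * dquad * Y^`()^`()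
    + (- 864 - 60) * Y^`().
  rewrite /hg21_op derivB derivD !derivM deriv_natr deriv_quad deriv_dquad; ring.
rewrite dE /sym2_op /hg21_op expr2 !(derivM, derivD) /quad /dquad; ring.
Qed.

(** The other half of Clausen's identity: pulled back along [quad], the
    equation of the 3F2 series becomes the symmetric square of that of the
    2F1 series. *)
Lemma sym2_op_comp S : sym2_op (S \Po quad) = dquad * (hg32_op S \Po quad).
Proof.
rewrite /sym2_op !(deriv_quad, deriv_dquad, deriv_natr, derivN, deriv_comp,
  derivM, derivD).
rewrite /hg32_op !(comp_poly1, comp_poly_natr, comp_polyX, comp_Xn_poly, comp_polyB,
  comp_polyD, comp_polyM).
rewrite /quad /dquad; ring.
Qed.

Lemma coef_hg21_op Y i : (hg21_op Y)`_i =
  i.+1%:R ^+ 2 * Y`_i.+1 - 12 * (6 * i%:R + 1) * (6 * i%:R + 5) * Y`_i.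
Proof.
have -> : hg21_op Y = 'X * Y^`()^`() - 432%:R%:P * ('X^2 * Y^`()^`()) + Y^`()
    - 864%:R%:P * ('X * Y^`()) - 60%:R%:P * Y.
  by rewrite /hg21_op /quad /dquad !polyC_natr; ring.
rewrite !(coefN, coefD, coefXM, coefXnM, coefCM, coef_deriv).
by case: i => [|[|i]] /=; rewrite ?subSS ?subn0; ring.
Qed.

Lemma coef_hg32_op F i : (hg32_op F)`_i =
  i.+1%:R ^+ 3 * F`_i.+1
  - 24 * (2 * i%:R + 1) * (6 * i%:R + 1) * (6 * i%:R + 5) * F`_i.
Proof.
have -> : hg32_op F = 'X^2 * F^`()^`()^`() - 1728%:R%:P * ('X^3 * F^`()^`()^`())
    + 3%:R%:P * ('X * F^`()^`()) - 3%:R%:P * (2592%:R%:P * ('X^2 * F^`()^`()))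
    + F^`() - 12%:R%:P * (452%:R%:P * ('X * F^`())) - 120%:R%:P * F.
  by rewrite /hg32_op !polyC_natr; ring.
rewrite !(coefN, coefD, coefXM, coefXnM, coefCM, coef_deriv).
by case: i => [|[|[|i]]] /=; rewrite ?subSS ?subn0; ring.
Qed.

(** The exponent 0 is the only root, with multiplicity three, of the indicial
    equation at the origin; so a solution is determined by its value there. *)
Lemma coef_sym2_op F m : (forall j, (j <= m)%N -> F`_j = 0) ->
  (sym2_op F)`_m = m.+1%:R ^+ 3 * F`_m.+1.
Proof.
move=> F0.
have -> : sym2_op F = 'X^2 * F^`()^`()^`() - 864%:R%:P * ('X^3 * F^`()^`()^`())
    + 432%:R%:P * (432%:R%:P * ('X^4 * F^`()^`()^`()))
    + 3%:R%:P * ('X * F^`()^`()) - 3%:R%:P * (1296%:R%:P * ('X^2 * F^`()^`()))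
    + 3%:R%:P * (432%:R%:P * (864%:R%:P * ('X^3 * F^`()^`())))
    + F^`() - 2832%:R%:P * ('X * F^`()) + 2832%:R%:P * (432%:R%:P * ('X^2 * F^`()))
    - 120%:R%:P * F + 120%:R%:P * (864%:R%:P * ('X * F)).
  by rewrite /sym2_op /quad /dquad !polyC_natr; ring.
rewrite !(coefN, coefD, coefXM, coefXnM, coefCM, coef_deriv).
have Fm := F0 _ (leqnn m); have Fm1 := F0 _ (leq_pred m).
by case: m {F0} Fm Fm1 => [|[|[|[|m]]]] /= Fm Fm1; rewrite ?subSS ?subn0 ?Fm ?Fm1; ring.
Qed.

End ODE.

(** The difference of the two sides is killed by [sym2_op] up to order N and
    vanishes at 0, so by [coef_sym2_op] its coefficients vanish one after the
    other. *)
Lemma clausen_exact (S Y : {poly int}) N :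
    (forall i, (i < N)%N -> (hg21_op Y)`_i = 0) ->
    (forall i, (i < N)%N -> (hg32_op S)`_i = 0) ->
    S`_0 = Y`_0 ^+ 2 ->
  forall i, (i <= N)%N -> (S \Po quad int)`_i = (Y ^+ 2)`_i.
Proof.
move=> Y0 S0 SY0.
have dvdX (F : {poly int}) : (forall i, (i < N)%N -> F`_i = 0) ->
    exists G, F = 'X^N * G.
  move=> F0; exists (drop_poly N F); rewrite -{1}(poly_take_drop N F) mulrC.
  rewrite (_ : take_poly N F = 0) ?add0r //.
  by apply/polyP => i; rewrite coef_take_poly coef0; case: ifP => // /F0.
have [GY YE] := dvdX _ Y0; have [GS SE] := dvdX _ S0.
pose F := S \Po quad int - Y ^+ 2.
have sym2F i : (i < N)%N -> (sym2_op F)`_i = 0.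
  have qE : quad int = 'X * (1 - 432 * 'X) by rewrite /quad; ring.
  have qdXN : quad int * ('X^N * GY)^`() =
      'X^N * ((1 - 432 * 'X) * (GY *+ N + 'X * GY^`())).
    case: (N) => [|M]; first by rewrite derivM derivXn qE mulr0n; ring.
    by rewrite derivM derivXn qE exprS -(mulr_natr 'X^_); ring.
  move=> ltiN.
  have -> : sym2_op F = 'X^N * (dquad int * (1 - 432 * 'X) ^+ N * (GS \Po quad int)
      - 2 * Y * ((1 - 432 * 'X) * (GY *+ N + 'X * GY^`()))
      - (6 * quad int * Y^`() + 2 * dquad int * Y) * GY).
    transitivity (sym2_op (S \Po quad int) - sym2_op (Y ^+ 2)).
      by rewrite /sym2_op /F !derivB; ring.
    rewrite sym2_op_square sym2_op_comp YE SE comp_polyM comp_Xn_poly {1}qE exprMn.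
    have -> : 2 * quad int * Y * ('X^N * GY)^`() =
        2 * Y * (quad int * ('X^N * GY)^`()) by ring.
    by rewrite qdXN; ring.
  by rewrite coefXnM ltiN.
have F0 : forall i, (i <= N)%N -> F`_i = 0.
  elim/ltn_ind => -[|i] IHi leiN.
    have q0 : (quad int).[0] = 0.
      by rewrite hornerD hornerN hornerM hornerX hornerXn expr0n mulr0 subrr.
    rewrite -horner_coef0 hornerD hornerN horner_comp horner_exp q0.
    by rewrite !horner_coef0 SY0 subrr.
  have := sym2F i leiN; rewrite coef_sym2_op => [/eqP|j leji]; last by apply: IHi; lia.
  by rewrite mulf_eq0 expf_eq0 pnatr_eq0 /= => /eqP.
by move=> i leiN; apply/eqP; rewrite -subr_eq0 -coefB F0.
Qed.

Definition f21_trunc (R : nzRingType) p : {poly R} := \poly_(k < p) (f21_coef k)%:R.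

Definition f32_trunc (R : nzRingType) p : {poly R} := \poly_(k < p) (f32_coef k)%:R.

Lemma map_f21_trunc (R S : nzRingType) (f : {rmorphism R -> S}) p :
  map_poly f (f21_trunc R p) = f21_trunc S p.
Proof.
apply/polyP => i; rewrite coef_map /f21_trunc /f32_trunc !coef_poly.
by case: ifP => _; [apply: rmorph_nat | apply: rmorph0].
Qed.

Lemma map_f32_trunc (R S : nzRingType) (f : {rmorphism R -> S}) p :
  map_poly f (f32_trunc R p) = f32_trunc S p.
Proof.
apply/polyP => i; rewrite coef_map /f21_trunc /f32_trunc !coef_poly.
by case: ifP => _; [apply: rmorph_nat | apply: rmorph0].
Qed.

Lemma map_quad (R S : comNzRingType) (f : {rmorphism R -> S}) :
  map_poly f (quad R) = quad S.
Proof. by rewrite rmorphB rmorphM /= rmorph_nat map_polyX map_polyXn. Qed.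

(** Beyond degree p - 1 both sides vanish.  In a product of two coefficients of
    indices below p and sum at least p, either both indices are at least p/6
    or one is at least 5p/6.  In degree i >= p, the powers of [quad] that
    contribute have exponent k >= i/2 >= p/2, where p^2 divides the 3F2
    coefficient. *)
Lemma clausen_mod (R : comNzRingType) p : prime p -> (5 < p)%N ->
  (p ^ 2)%:R = 0 :> R -> f32_trunc R p \Po quad R = f21_trunc R p ^+ 2.
Proof.
move=> p_pr p_gt5 pp0; have p_gt0 := prime_gt0 p_pr.
have dv0 k : (p ^ 2 %| k)%N -> k%:R = 0 :> R.
  by move=> /dvdnP[d ->]; rewrite natrM pp0 mulr0.
apply/polyP => i; have [ltip|leip] := ltnP i p.
  rewrite -(map_f32_trunc intr) -(map_f21_trunc intr) -(map_quad intr).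
  rewrite -map_comp_poly -rmorphXn /=.
  rewrite !coef_map /=; congr (_%:~R); apply: (@clausen_exact _ _ p.-1); last by lia.
  - move=> j ltj; rewrite coef_hg21_op !coef_poly !ifT; try lia.
    have /(congr1 (fun n : nat => n%:R : int)) := f21_coef_rec j.
    by rewrite !(natrM, natrX, natrD) => ->; rewrite subrr.
  - move=> j ltj; rewrite coef_hg32_op !coef_poly !ifT; try lia.
    have /(congr1 (fun n : nat => n%:R : int)) := f32_coef_rec j.
    by rewrite !(natrM, natrX, natrD) => ->; rewrite subrr.
  - by rewrite !coef_poly p_gt0.
rewrite expr2 coefM big1 => [|[j ltj] _ /=]; last first.
  rewrite !coef_poly; case: ifP => ltjp; last by rewrite mul0r.
  case: ifP => ltijp; last by rewrite mulr0.
  rewrite -natrM dv0 //; have [lej|ltj5] := leqP (5 * p) (6 * j).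
    by rewrite dvdn_mulr // dvdp2_f21_coef.
  have [leij|ltij5] := leqP (5 * p) (6 * (i - j)).
    by rewrite dvdn_mull // dvdp2_f21_coef.
  by rewrite expnS expn1 dvdn_mul // dvdp_f21_coef //; lia.
rewrite coef_comp_poly big1 // => [[k ltk] _ /=].
rewrite coef_poly; case: ifP => ltkp; last by rewrite mul0r.
have [le2|lt2] := leqP p (2 * k); first by rewrite dv0 ?mul0r // dvdp2_f32_coef.
rewrite nth_default ?mulr0 //; apply: leq_trans (size_poly_exp_leq _ _) _.
have szq : (size (quad R) <= 3)%N.
  have -> : quad R = 'X - 432%:R%:P * 'X^2 by rewrite polyC_natr.
  apply/leq_sizeP => j lej; rewrite coefB coefCM coefX coefXn.
  by case: j lej => [|[|[|j]]] //= _; rewrite mulr0 subr0.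
have : ((size (quad R)).-1 * k <= 2 * k)%N by rewrite leq_mul // -subn1 leq_subLR.
by move: ((_).-1 * k)%N => s; lia.
Qed.

(** * The Cartier operator in characteristic p *)

Section DerivationCharP.
Variables (K : fieldType) (p : nat) (chp : p \in [pchar K]).
Implicit Types F G : {poly K}.

Lemma deriv_Xp F : (F ^+ p)^`() = 0.
Proof. by rewrite deriv_exp -mulr_natr -polyC_natr pcharf0 // polyC0 mulr0. Qed.

Lemma derivn_mulXp F G k : (F ^+ p * G)^`(k) = F ^+ p * G^`(k).
Proof.
elim: k => [|k IHk]; first by rewrite !derivn0.
by rewrite !derivnS IHk derivM deriv_Xp mul0r add0r.
Qed.

Lemma derivn_pchar F : F^`(p) = 0.
Proof.
apply/polyP => i; rewrite coef0 coef_derivn -mulr_natr.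
apply/eqP; rewrite mulf_eq0 -(dvdn_pcharf chp) -bin_ffact dvdn_mull ?orbT //.
by rewrite prime_dvd_fact ?leqnn ?(pcharf_prime chp).
Qed.

(** On polynomials of degree at most 2p - 2, the (p-1)-st derivative reads off
    the coefficient of X^(p-1) alone.  In general this derivative is
    (p-1)! times the p-th power of the Cartier operator on forms F dX. *)
Lemma derivn_pred_pchar F : (size F <= (2 * p).-1)%N ->
  F^`(p.-1) = ((p.-1)`!%:R * F`_p.-1)%:P.
Proof.
move=> szF; have p_pr := pcharf_prime chp; have p_gt1 := prime_gt1 p_pr.
apply/polyP => -[|i]; rewrite coefC coef_derivn /=.
  by rewrite addn0 ffactnn mulr_natl.
have [ltip|leip] := ltnP i.+1 p; last first.
  by rewrite nth_default ?mul0rn // (leq_trans szF); lia.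
apply/eqP; rewrite -mulr_natr mulf_eq0 -(dvdn_pcharf chp); apply/orP; right.
have: (p %| (p.-1 + i.+1)`!)%N by rewrite prime_dvd_fact //; lia.
rewrite -(@ffact_fact _ p.-1) ?leq_addr // addKn Euclid_dvdM //.
by rewrite (@prime_dvd_fact p i.+1) // (leqNgt p) ltip orbF.
Qed.

Lemma fact_pred_neq0 : (p.-1)`!%:R != 0 :> K.
Proof.
have p_pr := pcharf_prime chp; have p_gt1 := prime_gt1 p_pr.
rewrite -(dvdn_pcharf chp) prime_dvd_fact //; lia.
Qed.

Lemma exprD_pchar F G : (F + G) ^+ p = F ^+ p + G ^+ p.
Proof.
by rewrite exprDn_pchar // (eq_pnat _ (@pchar_poly K)) pnatE ?(pcharf_prime chp).
Qed.

Lemma exprB_pchar F G : (F - G) ^+ p = F ^+ p - G ^+ p.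
Proof. by rewrite -{2}(subrK G F) (exprD_pchar (F - G)) addrK. Qed.

(** The Hasse invariant of a cubic is unchanged, up to a nonzero factor, by an
    affine change of variable: by [derivn_pred_pchar] it is a derivative. *)
Lemma coef_comp_affine (F : {poly K}) l m : l != 0 -> (size F <= (2 * p).-1)%N ->
  (F \Po (l *: 'X + m%:P))`_p.-1 = l ^+ p.-1 * F`_p.-1.
Proof.
move=> l0 szF; set L := _ + _.
have L' : L^`() = l%:P by rewrite derivD derivZ derivX derivC addr0 alg_polyC.
have derivnL k : (F \Po L)^`(k) = (l ^+ k) *: (F^`(k) \Po L).
  elim: k => [|k IHk]; first by rewrite !derivn0 scale1r.
  by rewrite !derivnS IHk derivZ deriv_comp L' mulrC mul_polyC scalerA exprSr.
have szL : size L = 2.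
  by rewrite size_polyDl size_scale // size_polyX // ltnS size_polyC_leq1.
have szFL : (size (F \Po L) <= (2 * p).-1)%N by rewrite size_comp_poly2.
have := derivnL p.-1.
rewrite !derivn_pred_pchar // comp_polyC -mul_polyC -polyCM => /polyC_inj.
by rewrite mulrCA => /(mulfI fact_pred_neq0).
Qed.

End DerivationCharP.

Section CartierForms.
Variables (K : closedFieldType) (p : nat) (chp : p \in [pchar K]).
Implicit Types F G : {poly K}.

(** The Cartier operator fixes logarithmic differentials.  Multiplied by F^p,
    the form dF/F becomes polynomial; logarithmic differentials add up under
    products, which reduces the identity to linear factors. *)
Lemma derivn_log F :
  (F ^+ p.-1 * F^`())^`(p.-1) = (p.-1)`!%:R * F^`() ^+ p.
Proof.
have p_pr := pcharf_prime chp; have p_gt1 := prime_gt1 p_pr.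
have pE : p.-1.+1 = p by rewrite prednK // prime_gt0.
have [s ->] := closed_field_poly_normal F; elim: s => [|r s IHs].
  rewrite big_nil alg_polyC derivC mulr0 expr0n -{3}pE /=.
  by rewrite mulr0 derivn_poly0 ?size_poly0.
rewrite big_cons scalerAr; set A := 'X - _; move: (_ *: _) IHs => B IHs.
have A'E : A^`() = 1 by rewrite derivXsubC.
have IHA : (A ^+ p.-1)^`(p.-1) = (p.-1)`!%:R.
  rewrite (derivn_pred_pchar chp) // ?size_exp_XsubC; last by lia.
  have /monicP := monic_exp p.-1 (monicXsubC r).
  by rewrite lead_coefE size_exp_XsubC /= => ->; rewrite mulr1 polyC_natr.
have -> : (A * B) ^+ p.-1 * (A * B)^`() =
    B ^+ p * A ^+ p.-1 + A ^+ p * (B ^+ p.-1 * B^`()).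
  by rewrite derivM A'E -pE !exprS !exprMn; ring.
rewrite derivnD !(derivn_mulXp chp) IHs IHA.
by rewrite derivM A'E mul1r (exprD_pchar chp B) exprMn; ring.
Qed.

(** The Cartier operator on R^(p-1) dR for the fraction R = N/E, cleared of
    denominators: R^(p-1) dR is R^p times the logarithmic differential of
    R. *)
Lemma derivn_wronskian (N E : {poly K}) (W := N^`() * E - N * E^`()) :
  (N ^+ p.-1 * E ^+ p.-1 * W)^`(p.-1) = (p.-1)`!%:R * W ^+ p.
Proof.
have p_pr := pcharf_prime chp; have p_gt0 := prime_gt0 p_pr.
have -> : N ^+ p.-1 * E ^+ p.-1 * W =
    E ^+ p * (N ^+ p.-1 * N^`()) - N ^+ p * (E ^+ p.-1 * E^`()).
  by rewrite /W -(prednK p_gt0) !exprS /=; ring.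
rewrite derivnB !(derivn_mulXp chp) !derivn_log /W.
by rewrite (exprB_pchar chp) !exprMn; ring.
Qed.

(** Here the form is R^m dR with R = N/E and m + 1 nonzero in K, up to the p-th
    power E^(2p); it is exact, hence killed by the Cartier operator. *)
Lemma derivn_wronskian0 (N E : {poly K}) m k :
  ((m + k).+2 = 2 * p)%N -> m.+1%:R != 0 :> K ->
  (N ^+ m * E ^+ k * (N^`() * E - N * E^`()))^`(p.-1) = 0.
Proof.
move=> mkE m1_neq0; have p_pr := pcharf_prime chp; have p_gt0 := prime_gt0 p_pr.
have k1E : k.+1%:R = - m.+1%:R :> {poly K}.
  apply/eqP; rewrite -addr_eq0 -natrD; have -> : (k.+1 + m.+1 = 2 * p)%N by lia.
  by rewrite -polyC_natr natrM (pcharf0 chp) mulr0 polyC0.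
have dE : (N ^+ m.+1 * E ^+ k.+1)^`() =
    m.+1%:R * (N ^+ m * E ^+ k * (N^`() * E - N * E^`())).
  rewrite derivM !deriv_exp -(mulr_natr (_ * _) m.+1).
  by rewrite -(mulr_natr (_ * _) k.+1) k1E /= !exprS; ring.
have: ((N ^+ m.+1 * E ^+ k.+1)^`())^`(p.-1) = 0.
  by rewrite -derivSn prednK ?derivn_pchar.
rewrite dE -polyC_natr mul_polyC derivnZ -mul_polyC => /eqP.
by rewrite mulf_eq0 polyC_eq0 (negPf m1_neq0) => /eqP.
Qed.

End CartierForms.

(** * Isogenies and the Hasse invariant *)

Lemma mulr_expf_div (F : fieldType) (c x y : F) i m : (i <= m)%N -> y != 0 ->
  c * (x ^+ i * y ^+ (m - i)) = c * (x / y) ^+ i * y ^+ m.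
Proof.
move=> le_im y0; rewrite expr_div_n -{2}(subnK le_im) exprD; field.
by rewrite expf_neq0.
Qed.

Section Homogenization.
Variable K : fieldType.

Local Notation tofrac := (@FracField.tofrac {poly K}).
Local Notation "x %:F" := (tofrac x).

(** Passing to the fraction N/E turns homogenization into evaluation, which is
    multiplicative in g; this is what [homog_exp] uses. *)
Lemma tofrac_homog (g N E : {poly K}) m (E_neq0 : E != 0) : (size g <= m.+1)%N ->
  (\sum_(i < m.+1) g`_i *: (N ^+ i * E ^+ (m - i)))%:F =
  (map_poly (tofrac \o polyC) g).[N%:F / E%:F] * E%:F ^+ m.
Proof.
move=> szg; rewrite (@horner_coef_wide _ m.+1); last first.
  by rewrite (leq_trans (size_poly _ _)).
rewrite rmorph_sum mulr_suml; apply: eq_bigr => i _ /=.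
rewrite coef_map /= -mul_polyC !rmorphM !rmorphXn /=.
by apply: mulr_expf_div; rewrite ?tofrac_eq0 // -ltnS.
Qed.

Lemma homog_exp (f N E : {poly K}) d n : E != 0 -> (size f <= d.+1)%N ->
  (\sum_(i < d.+1) f`_i *: (N ^+ i * E ^+ (d - i))) ^+ n =
  \sum_(i < (d * n).+1) (f ^+ n)`_i *: (N ^+ i * E ^+ (d * n - i)).
Proof.
move=> E_neq0 szf; apply/eqP; rewrite -tofrac_eq; apply/eqP.
rewrite rmorphXn /= !tofrac_homog //; last first.
  by rewrite (leq_trans (size_poly_exp_leq _ _)) // ltnS leq_mul2r; lia.
by rewrite rmorphXn /= horner_exp exprMn exprM.
Qed.

End Homogenization.

(** The pair (N/e^2, y s/e^3) maps the curve y^2 = f(x) to itself and pulls dx/y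
    back to al dx/y.  Apply the Cartier operator to the pullback of
    f^n dx, written in two ways.  Expanding f(N/e^2)^n in powers of N/e^2, only
    the power p - 1 survives, and gives the Hasse invariant times the p-th
    power of the derivative of N/e^2, that is with a factor al^p.  Using the
    equation of the curve instead, f(N/e^2)^n is f^n times a power of s that the
    derivative completes to a p-th power, with a factor al. *)
Lemma hasse_isogeny0 (K : closedFieldType) p (chp : p \in [pchar K]) n
    (f N e s : {poly K}) (al : K) :
    p = n.*2.+1 -> (size f <= 4)%N -> e != 0 -> s != 0 ->
    N^`() * e - N * e^`() *+ 2 = al *: s ->
    \sum_(i < 4) f`_i *: (N ^+ i * (e ^+ 2) ^+ (3 - i)) = f * s ^+ 2 ->
  al ^+ p != al -> (f ^+ n)`_p.-1 = 0.
Proof.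
move=> pE szf e_neq0 s_neq0 Nal fNe alp.
have p_pr := pcharf_prime chp; have p_gt1 := prime_gt1 p_pr.
(* A is the Hasse invariant. *)
set A := _`__; pose E := e ^+ 2; pose W := N^`() * E - N * E^`().
have WE : W = al *: (e * s).
  rewrite scalerAr -Nal /W /E deriv_exp /= -mulr_natr; ring.
have E_neq0 : E != 0 by rewrite expf_neq0.
(* The factor E^n makes the total degree in N and E of each term equal to
   4n = 2p - 2, as [derivn_wronskian0] requires. *)
have dL : (f ^+ n * W * (s ^+ (n.*2) * E ^+ n))^`(p.-1) =
    (p.-1)`!%:R *: (A *: W ^+ p).
  have -> : f ^+ n * W * (s ^+ n.*2 * E ^+ n) = E ^+ n * W * (f * s ^+ 2) ^+ n.
    by rewrite (exprMn n f) -(exprM s) mul2n; ring.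
  rewrite -fNe homog_exp // mulr_sumr linear_sum /=.
  have lt_p1 : (p.-1 < (3 * n).+1)%N by lia.
  rewrite (bigD1 (Ordinal lt_p1)) //= big1 ?addr0 => [|i ne_i].
    rewrite -scalerAr linearZ /= -/A.
    have -> : E ^+ n * W * (N ^+ p.-1 * E ^+ (3 * n - p.-1)) =
        N ^+ p.-1 * E ^+ p.-1 * W.
      have -> : E ^+ p.-1 = E ^+ n * E ^+ (3 * n - p.-1).
        by rewrite -exprD; congr (_ ^+ _); lia.
      ring.
    by rewrite (derivn_wronskian chp) -polyC_natr mul_polyC !scalerA mulrC.
  rewrite -scalerAr linearZ /=.
  have -> : E ^+ n * W * (N ^+ i * E ^+ (3 * n - i)) =
      N ^+ i * E ^+ (n + (3 * n - i)) * W by rewrite exprD; ring.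
  have lti := ltn_ord i.
  rewrite (derivn_wronskian0 chp) ?scaler0 //; first by lia.
  rewrite -(dvdn_pcharf chp); apply/negP => /dvdnP[k kE].
  (* i + 1 is a multiple of p and at most 3n + 1 < 2p. *)
  have k1 : (k = 1)%N.
    have : (k * p < 2 * p)%N by lia.
    have : (0 < k * p)%N by lia.
    by rewrite ltn_pmul2r ?muln_gt0; lia.
  case/eqP: ne_i; apply: val_inj => /=; lia.
have dR : (f ^+ n * W * (s ^+ n.*2 * E ^+ n))^`(p.-1) =
    (p.-1)`!%:R *: (A *: (al *: (e * s) ^+ p)).
  have -> : f ^+ n * W * (s ^+ n.*2 * E ^+ n) = (e * s) ^+ p * (al *: f ^+ n).
    by rewrite WE -!mul_polyC pE exprS (exprMn _ e s) /E -(exprM e 2) mul2n; ring.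
  rewrite (derivn_mulXp chp) linearZ /= (derivn_pred_pchar chp) -/A.
    by rewrite -!mul_polyC polyCM; ring.
  apply: leq_trans (size_poly_exp_leq _ _) _.
  by apply: (@leq_trans (3 * n).+1); [rewrite ltnS leq_mul // -subn1 leq_subLR | lia].
move: dL; rewrite dR WE exprZn => /eqP.
have es_neq0 : (e * s) ^+ p != 0 by rewrite expf_neq0 // mulf_neq0.
rewrite -subr_eq0 -!scalerBr -scalerBl !scaler_eq0 subr_eq0 (negPf es_neq0).
by rewrite (eq_sym al) (negPf alp) (negPf (fact_pred_neq0 chp)) !orbF => /eqP.
Qed.

(** * The curve with complex multiplication of discriminant -19 *)

Section Isogeny19.
Variables (R : comNzRingType) (x a : R).

(** Multiplication by a on y^2 = x^3 - 152 x + 722, where a^2 - a + 5 = 0, is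
    x -> [iso_num] / [iso_den]^2, y -> y [iso_y] / [iso_den]^3.  The formulas
    come from expanding wp(a z) as a rational fraction in wp(z); the numerator
    and the denominators are scaled by powers of a so as to have integral
    coefficients. *)
Definition iso_num := x ^+ 5 + (4 * a - 40) * x ^+ 4 + 19 * (60 - 20 * a) * x ^+ 3
  + 19 * (384 * a - 800) * x ^+ 2 + 19 ^+ 2 * (240 - 144 * a) * x
  + 19 ^+ 2 * (352 * a - 480).

Definition iso_den := a * x ^+ 2 - (10 + 18 * a) * x + 76 * (1 + a).

Definition iso_y := x ^+ 6 + (6 * a - 60) * x ^+ 5 + 19 * 44 * x ^+ 4
  - 19 * (104 + 96 * a) * x ^+ 3 + 19 ^+ 2 * (48 * a - 96) * x ^+ 2
  + 19 ^+ 2 * (672 - 128 * a) * x - 64 * 19 ^+ 3.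

Definition iso_dnum := 5 * x ^+ 4 + 4 * (4 * a - 40) * x ^+ 3
    + 3 * (19 * (60 - 20 * a)) * x ^+ 2 + 2 * (19 * (384 * a - 800)) * x
    + 19 ^+ 2 * (240 - 144 * a).

Definition iso_dden := 2 * a * x - (10 + 18 * a).

Hypothesis aE : a ^+ 2 = a - 5.

Lemma iso_curve :
  iso_num ^+ 3 - 152 * iso_num * iso_den ^+ 4 + 722 * iso_den ^+ 6 =
  (x ^+ 3 - 152 * x + 722) * iso_y ^+ 2.
Proof. rewrite /iso_num /iso_den /iso_y; ring: aE. Qed.

Lemma iso_differential :
  iso_dnum * iso_den - 2 * iso_num * iso_dden = a * iso_y.
Proof. rewrite /iso_dnum /iso_dden /iso_num /iso_den /iso_y; ring: aE. Qed.

End Isogeny19.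

Lemma deriv_iso_num (R : comNzRingType) (a : R) :
  (iso_num 'X a%:P)^`() = iso_dnum 'X a%:P.
Proof.
rewrite /iso_num /iso_dnum.
rewrite !(deriv_natr, derivC, derivXn, derivX, derivN, derivD, derivM) /=; ring.
Qed.

Lemma deriv_iso_den (R : comNzRingType) (a : R) :
  (iso_den 'X a%:P)^`() = iso_dden 'X a%:P.
Proof.
rewrite /iso_den /iso_dden.
rewrite !(deriv_natr, derivC, derivXn, derivX, derivN, derivD, derivM) /=; ring.
Qed.

(** The curve y^2 = x^3 - 152 x + 722 has j-invariant (-96)^3. *)
Definition cm19 (K : fieldType) : {poly K} := 'X^3 - 152 * 'X + 722.

Lemma hasse_cm19 (K : closedFieldType) p n (a : K) :
    p \in [pchar K] -> p = n.*2.+1 -> a ^+ 2 = a - 5 -> a ^+ p != a ->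
  (cm19 K ^+ n)`_p.-1 = 0.
Proof.
move=> chp pE aE ap; have p_gt0 := prime_gt0 (pcharf_prime chp).
have aPE : a%:P ^+ 2 = a%:P - 5 :> {poly K}.
  by rewrite -rmorphXn /= aE rmorphB -polyC_natr.
have a_neq0 : a != 0 by apply: contraNneq ap => ->; rewrite expr0n gtn_eqF.
apply: (@hasse_isogeny0 _ _ chp _ _ (iso_num 'X a%:P) (iso_den 'X a%:P)
  (iso_y 'X a%:P) a) => //.
- rewrite (@leq_trans 4) // /cm19 !polyC_natE mul_polyC.
  apply/leq_sizeP => i i4; rewrite !coefE.
  by case: i i4 => [|[|[|[|i]]]] //= _; rewrite mulr0 subr0 addr0.
- apply/eqP => /(congr1 (fun F : {poly K} => F`_2)) /eqP; apply/negP.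
  rewrite /iso_den !polyC_natE -!(polyCM, polyCD) !coefE /=.
  by rewrite mulr1 mulr0 subr0 addr0.
- apply/eqP => /(congr1 (fun F : {poly K} => F`_6)) /eqP; apply/negP.
  rewrite /iso_y !polyC_natE -!(polyC_exp, polyCM, polyCB, polyCD) !coefE /=.
  by rewrite !(mulr0, subr0, addr0, oner_eq0).
- rewrite deriv_iso_num deriv_iso_den -mul_polyC -(iso_differential 'X aPE).
  ring.
- rewrite !big_ord_recr big_ord0 /= -(iso_curve 'X aPE).
  rewrite /cm19 !polyC_natE mul_polyC !coefE /=.
  rewrite !(mulr0, mulr1, subr0, sub0r, add0r, addr0, oppr0).
  by rewrite scale0r scale1r -!mul_polyC polyCN !polyC_natr; ring.
Qed.

Definition nonresidues19 := [:: 2; 3; 8; 10; 12; 13; 14; 15; 18]%N.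

Lemma jacobi19_nonresidue p : jacobi p%:Z 19 = -1 ->
  (p %% 19)%N \in nonresidues19.
Proof.
rewrite /jacobi (_ : primes 19 = [:: 19]%N) // big_seq1.
rewrite (_ : logn 19 19 = 1%N) // expr1.
rewrite /legendre; case: ifP => // _; case: ifP => // /negbT/existsPn nsq _.
have nsq' (x : nat) : (x < 19)%N -> (p %% 19 != x ^ 2 %% 19)%N.
  move=> ltx; apply: contraNneq (nsq (Ordinal ltx)) => E.
  by rewrite /= expr2 -PoszM !modz_nat E -mulnn.
have /allP/(_ (p %% 19)%N) : all (fun r => (r \in nonresidues19) ||
    has (fun x => r == x ^ 2 %% 19)%N (iota 0 19)) (iota 0 19) by [].
rewrite mem_iota ltn_pmod // => /(_ isT)/orP[//|/hasP[x]].
by rewrite mem_iota /= add0n => /nsq'/negPf->.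
Qed.

(** The opposite a of the sum of z^r over the squares r modulo 19, for z a
    primitive 19th root of unity, satisfies a^2 - a + 5 = 0.  The Frobenius
    map multiplies the exponents by p, hence exchanges this period with the
    other one when p is not a square; this plays the part of quadratic
    reciprocity. *)
Lemma gauss_period19 (K : closedFieldType) p : p \in [pchar K] ->
    (p %% 19)%N \in nonresidues19 ->
  exists2 a : K, a ^+ 2 = a - 5 & a ^+ p != a.
Proof.
move=> chp p19; have /closed_rootP[z] : size (\poly_(i < 19) 1 : {poly K}) != 1%N.
  by rewrite size_poly_eq // oner_eq0.
rewrite /root horner_poly !big_ord_recr big_ord0 /= !mul1r add0r.
set S := (X in X == 0) => /eqP z0.
have z19 : z ^+ 19 = 1.
  by apply: subr0_eq; transitivity ((z - 1) * S); [rewrite /S; ring | rewrite z0 mulr0].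
pose a := - (z + z ^+ 4 + z ^+ 5 + z ^+ 6 + z ^+ 7 + z ^+ 9 + z ^+ 11
  + z ^+ 16 + z ^+ 17).
have aE : a ^+ 2 = a - 5.
  transitivity (a - 5 + 5 * S); last by rewrite z0 mulr0 addr0.
  by rewrite /a /S; ring: z19.
have ap : a ^+ p = 1 - a.
  transitivity (1 - a - S); last by rewrite z0 subr0.
  rewrite /a /S -(pFrobenius_autE chp) rmorphN !rmorphD !rmorphXn /= pFrobenius_autE.
  have -> : z ^+ p = z ^+ (p %% 19) by rewrite expr_mod.
  by move: p19; rewrite /nonresidues19 !inE; do ![case/orP]; move=> /eqP->; ring: z19.
exists a => //; apply/eqP; rewrite ap => a1.
(* Otherwise 2a = 1, but (2a - 1)^2 = -19. *)
have : (19%:R : K) = 0.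
  have -> : (19%:R : K) = 4 * (5 - a + a ^+ 2) - (a - (1 - a)) ^+ 2 by ring.
  by rewrite aE a1; ring.
move/eqP; rewrite -(dvdn_pcharf chp) dvdn_prime2 ?(pcharf_prime chp) //.
by move/eqP=> p_19; move: p19; rewrite p_19.
Qed.

(** The primes 2, 3 and 19 are those of bad reduction of the models used
    here. *)
Lemma natr_bad_prime_neq0 (K : fieldType) p q : p \in [pchar K] -> (5 < p)%N ->
    (p %% 19)%N \in nonresidues19 ->
  q \in [:: 2; 3; 19]%N -> q%:R != 0 :> K.
Proof.
move=> chp p_gt5 p19 q_in; rewrite -(dvdn_pcharf chp); have p_pr := pcharf_prime chp.
by move: q_in; rewrite !inE => /or3P[] /eqP->; rewrite dvdn_prime2 //; apply/eqP => E;
  move: p19 p_gt5; rewrite E.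
Qed.

(** * The truncated series as a Hasse invariant *)

Lemma bin_trinomial3 n k :
  ('C(n, k) * 'C(n - k, 2 * k) = 'C(n, 3 * k) * 'C(3 * k, k))%N.
Proof.
have [le3|lt3] := leqP (3 * k) n; last first.
  by rewrite (bin_small lt3) ['C(n - k, _)]bin_small ?muln0 //; lia.
have h1 := @bin_fact n k ltac:(lia).
have h2 := @bin_fact (n - k) (2 * k) ltac:(lia).
have h3 := @bin_fact n (3 * k) ltac:(lia).
have h4 := @bin_fact (3 * k) k ltac:(lia).
rewrite (_ : n - k - 2 * k = n - 3 * k)%N in h2; last by lia.
rewrite (_ : 3 * k - k = 2 * k)%N in h4; last by lia.
set d := (k`! * (2 * k)`! * (n - 3 * k)`!)%N.
have d0 : (0 < d)%N by rewrite !muln_gt0 !fact_gt0.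
apply/eqP; rewrite -(eqn_pmul2r d0); apply/eqP; rewrite /d.
transitivity n`!; [rewrite -h1 -h2; ring | rewrite -h3 -h4; ring].
Qed.

(** Expand in powers of the constant term: X^2 (4X + 1) - 4t. *)
Lemma coef_exp_cubic (R : comNzRingType) (t : R) n :
  ((4 * 'X^3 + 'X^2 - 4 * t%:P) ^+ n)`_(n.*2) =
  \sum_(k < n.+1) (- 64) ^+ k * ('C(n, 3 * k) * 'C(3 * k, k))%:R * t ^+ k.
Proof.
have -> : 4 * 'X^3 + 'X^2 - 4 * t%:P = 'X^2 * (4 *: 'X + 1) + (- 4 * t)%:P.
  by rewrite -mul_polyC rmorphM rmorphN /= polyC_natr; ring.
rewrite exprDn coef_sum; apply: eq_bigr => k _.
have lekn : (k <= n)%N by rewrite -ltnS.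
rewrite coefMn -rmorphXn /= coefMC exprMn -exprM coefXnM.
rewrite ltnNge (_ : (2 * (n - k) <= n.*2)%N) /=; last by lia.
rewrite (_ : n.*2 - 2 * (n - k) = 2 * k)%N; last by lia.
have -> : ((4 *: 'X + 1) ^+ (n - k))`_(2 * k) = 4 ^+ (2 * k) *+ 'C(n - k, 2 * k) :> R.
  rewrite addrC exprDn coef_sum.
  have [le2|lt2] := leqP (2 * k) (n - k); last first.
    rewrite bin_small // mulr0n big1 // => i _.
    rewrite expr1n mul1r coefMn exprZn coefZ coefXn.
    by rewrite gtn_eqF ?mulr0 ?mul0rn // (leq_trans _ lt2).
  rewrite (bigD1 (Ordinal (le2 : (2 * k < (n - k).+1)%N))) //= big1 ?addr0.
    by rewrite expr1n mul1r coefMn exprZn coefZ coefXn eqxx mulr1.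
  move=> i ne_i; rewrite expr1n mul1r coefMn exprZn coefZ coefXn.
  case: eqP => [E|_]; last by rewrite mulr0 mul0rn.
  by case/eqP: ne_i; apply: val_inj; rewrite /= -E.
rewrite exprMn mulrnAl -mulrnA (mulnC 'C(n - k, _)) bin_trinomial3 -(mulr_natr (_ * _)).
have -> : - 64 = 4 ^+ 2 * - 4 :> R by ring.
rewrite (exprMn _ (4 ^+ 2)) -(exprM 4 2); ring.
Qed.

Section HasseTruncated.
Variables (K : fieldType) (p n : nat).
Hypotheses (chp : p \in [pchar K]) (pE : p = n.*2.+1).

(** Modulo p one has n = -1/2, and C(2j,j) = (-4)^j C(-1/2,j). *)
Lemma central_bin_pchar j : (j < p)%N ->
  'C(2 * j, j)%:R = (- 4) ^+ j * 'C(n, j)%:R :> K.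
Proof.
elim: j => [|j IHj] ltj; first by rewrite muln0 !bin0 mulr1.
have j1 : j.+1%:R != 0 :> K by rewrite -(dvdn_pcharf chp) gtnNdvd.
apply: (mulfI j1).
have h2 : (j.+1%:R * 'C(n, j.+1)%:R = (n%:R - j%:R) * 'C(n, j)%:R :> K).
  rewrite -natrM mul_bin_left natrM; have [le|lt] := leqP j n; first by rewrite natrB.
  by rewrite bin_small // !mulr0.
rewrite -natrM central_bin_rec exprS mulrCA -mulrA h2 !natrM natrD natrM.
rewrite IHj; last by lia.
have n2 : 2 * n%:R + 1 = 0 :> K.
  by rewrite -(natrM K 2) -[1]/(1%:R) -natrD -(pcharf0 chp) pE; congr (_%:R); lia.
have -> : 2 * j%:R + 1 = - 2 * (n%:R - j%:R) :> K.
  by apply: subr0_eq; rewrite -n2; ring.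
ring.
Qed.

Hypothesis (p_gt5 : (5 < p)%N).

(** For 3k < p this is [central_bin_pchar]; otherwise both sides vanish, the
    left one because p <= 6k. *)
Lemma f21_coef_pchar k : (k < p)%N ->
  (f21_coef k)%:R = (- 64) ^+ k * ('C(n, 3 * k) * 'C(3 * k, k))%:R :> K.
Proof.
move=> ltk; have [lt3|le3] := ltnP (3 * k) p.
  rewrite /f21_coef natrM (_ : 6 * k = 2 * (3 * k))%N; last by lia.
  rewrite central_bin_pchar // exprM (_ : (- 4) ^+ 3 = - 64); last by ring.
  by rewrite natrM; ring.
have /eqP-> : (f21_coef k)%:R == 0 :> K.
  by rewrite -(dvdn_pcharf chp) dvdp_f21_coef ?(pcharf_prime chp) //; lia.
by rewrite (@bin_small n) ?mulr0 //; lia.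
Qed.

Lemma hasse_cubic (t : K) :
  \sum_(k < p) (f21_coef k)%:R * t ^+ k =
  ((4 * 'X^3 + 'X^2 - 4 * t%:P) ^+ n)`_p.-1.
Proof.
have -> : p.-1 = n.*2 by rewrite pE.
rewrite coef_exp_cubic.
pose c k := (- 64) ^+ k * ('C(n, 3 * k) * 'C(3 * k, k))%:R * t ^+ k.
rewrite (big_ord_widen_cond p xpredT c); last by lia.
rewrite [RHS]big_mkcond /=; apply: eq_bigr => k _; rewrite f21_coef_pchar //.
case: ifP => // /negbT; rewrite -leqNgt => ltnk.
by rewrite (@bin_small n) ?mulr0 ?mul0r //; lia.
Qed.

End HasseTruncated.

Lemma cubic_affine (K : fieldType) (l m t c b a : K) :
    c = 4 * l ^+ 3 -> 12 * m = - 1 -> 12 * l * m ^+ 2 + 2 * l * m = c * b ->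
    4 * m ^+ 3 + m ^+ 2 - 4 * t = c * a ->
  (4 * 'X^3 + 'X^2 - 4 * t%:P) \Po (l *: 'X + m%:P) =
    c *: ('X^3 + b%:P * 'X + a%:P).
Proof.
move=> cE mE bE aE; rewrite -!mul_polyC.
have natC (k : nat) : k%:R = k%:R%:P :> {poly K} by rewrite polyC_natr.
rewrite comp_polyB comp_polyD (comp_polyM 4 _%:P) (comp_polyM 4) !comp_Xn_poly.
rewrite (natC 4) !comp_polyC -natC.
apply: subr0_eq.
transitivity ((4 * l ^+ 3 - c)%:P * 'X^3 + ((12 * m + 1) * l ^+ 2)%:P * 'X^2
  + (12 * l * m ^+ 2 + 2 * l * m - c * b)%:P * 'X
  + (4 * m ^+ 3 + m ^+ 2 - 4 * t - c * a)%:P).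
  by rewrite !(polyC_natr, polyC1, polyC_exp, polyCN, polyCD, polyCM); ring.
by rewrite bE aE mE cE !subrr addNr mul0r !mul0r !addr0.
Qed.

(** With mu^2 = 456 and w = 3 mu/64, the substitution
    x -> x/(4 mu) - 1/12 turns the curve into [cm19]. *)
Lemma hasse_cubic_cm19 (K : closedFieldType) p n (w t : K) :
    p \in [pchar K] -> p = n.*2.+1 -> (5 < p)%N ->
    (p %% 19)%N \in nonresidues19 ->
    512 * w ^+ 2 = 513 -> 864 * t = 1 - w ->
  \sum_(k < p) (f21_coef k)%:R * t ^+ k = 0.
Proof.
move=> chp pE p_gt5 p19 wE tE; have p_pr := pcharf_prime chp.
have nz := natr_bad_prime_neq0 chp p_gt5 p19.
have n2 := nz 2 isT; have n3 := nz 3 isT; have n19 := nz 19 isT.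
have [a aE ap] := gauss_period19 chp p19.
have Z := hasse_cm19 chp pE aE ap.
rewrite (hasse_cubic chp pE p_gt5).
have n64 : 64 != 0 :> K by rewrite (_ : 64 = 2 ^+ 6); [rewrite expf_neq0 | ring].
have n9 : 9 != 0 :> K by rewrite (_ : 9 = 3 ^+ 2); [rewrite expf_neq0 | ring].
have n456 : 456 != 0 :> K.
  by rewrite (_ : 456 = 2 ^+ 3 * 3 * 19); [rewrite !mulf_neq0 ?expf_neq0 | ring].
have [mu [muE wmu]] : exists mu : K, mu ^+ 2 = 456 /\ w = 3 / 64 * mu.
  exists (64 / 3 * w); split.
    transitivity (8 / 9 * (512 * w ^+ 2)); last rewrite wE; field;
      rewrite ?n3 n9 ?n3 //.
  by rewrite !mulrA divfK // divff // mul1r.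
have mu0 : mu != 0 by apply: contra_eq_neq muE => ->; rewrite expr0n eq_sym.
have n12 : 12 != 0 :> K.
  by rewrite (_ : 12 = 2 ^+ 2 * 3); [rewrite mulf_neq0 ?expf_neq0 | ring].
have n864 : 864 != 0 :> K.
  by rewrite (_ : 864 = 2 ^+ 5 * 3 ^+ 3); [rewrite mulf_neq0 ?expf_neq0 | ring].
have n4 : 4 != 0 :> K by rewrite (_ : 4 = 2 ^+ 2); [rewrite expf_neq0 | ring].
have l0 : (4 * mu)^-1 != 0 by rewrite invr_eq0 mulf_neq0.
pose f := 4 * 'X^3 + 'X^2 - 4 * t%:P.
have szf : (size (f ^+ n) <= (2 * p).-1)%N.
  apply: leq_trans (size_poly_exp_leq _ _) _.
  have sz4 : (size f <= 4)%N.
    have -> : f = 4 *: 'X^3 + 'X^2 - (4 * t)%:P.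
      by rewrite /f -mul_polyC polyCM !polyC_natr.
    apply/leq_sizeP => i i4; rewrite !coefE.
    by case: i i4 => [|[|[|[|i]]]] //= _; rewrite ?(mulr0, subr0, addr0).
  apply: (@leq_trans (3 * n).+1); last by clear -pE; lia.
  by rewrite ltnS leq_mul // -subn1 leq_subLR.
apply: (mulfI (expf_neq0 p.-1 l0)).
rewrite -(coef_comp_affine chp (- 12^-1) l0 szf) rmorphXn /=.
rewrite (@cubic_affine _ _ _ _ (4 * ((4 * mu)^-1) ^+ 3) (- 152) 722) //.
- by rewrite polyCN !polyC_natr mulNr exprZn coefZ -/(cm19 K) Z !mulr0.
- by field.
- by field: muE; rewrite mu0 n4.
- have -> : t = (1 - 3 / 64 * mu) / 864 by rewrite -wmu -tE; field.
  by field: muE; rewrite mu0 n4 n864 n64.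
Qed.

(** * The congruence modulo p^2 *)

(** In the variable w with t = (1 - w)/864, the truncated series vanishes at
    both square roots of d; adding and subtracting the two values isolates
    its even and odd parts. *)
Lemma f21_parts_root (K : closedFieldType) p n (d : K) :
    p \in [pchar K] -> p = n.*2.+1 -> (5 < p)%N ->
    (p %% 19)%N \in nonresidues19 ->
    512 * d = 513 -> forall u : K, 864 * u = 1 ->
  let G := f21_trunc K p \Po (u *: (1 - 'X)) in
  (even_poly G).[d] = 0 /\ (odd_poly G).[d] = 0.
Proof.
move=> chp pE p_gt5 p19 dE u uE G.
have p_pr := pcharf_prime chp.
have /closed_rootP[w] : size ('X^2 - d%:P) != 1%N by rewrite size_XnsubC.
rewrite /root hornerD hornerN hornerXn hornerC subr_eq0 => /eqP wd.
have G0 x : x ^+ 2 = d -> G.[x] = 0.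
  move=> xd; rewrite horner_comp horner_poly.
  rewrite hornerZ hornerD hornerN hornerC hornerX.
  apply: (hasse_cubic_cm19 chp pE p_gt5 p19 (w := x)); first by rewrite xd.
  by rewrite mulrA uE mul1r.
have Gw x : G.[x] = (even_poly G).[x ^+ 2] + (odd_poly G).[x ^+ 2] * x.
  by rewrite -{1}[G]poly_even_odd hornerD hornerM !horner_comp hornerXn hornerX.
have := G0 w wd; have := G0 (- w); rewrite !Gw sqrrN wd mulrN => /(_ erefl) Gm Gp.
have n2 : 2 != 0 :> K by rewrite -(dvdn_pcharf chp) gtnNdvd //; lia.
have w0 : w != 0.
  have nz := natr_bad_prime_neq0 chp p_gt5 p19.
  apply: contra_eq_neq dE => w0; rewrite -wd w0 expr0n mulr0 eq_sym.
  by rewrite (_ : 513 = 3 ^+ 3 * 19); [rewrite mulf_neq0 ?expf_neq0 ?nz | ring].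
have A0 : (even_poly G).[d] = 0.
  apply: (mulfI n2); rewrite mulr0.
  transitivity ((even_poly G).[d] - (odd_poly G).[d] * w
    + ((even_poly G).[d] + (odd_poly G).[d] * w)); first by ring.
  by rewrite Gm Gp addr0.
split=> //; apply: (mulIf w0); rewrite mul0r.
by move: Gp; rewrite A0 add0r.
Qed.

(** The roots of t (1 - 432 t) = z are symmetric about 1/864, so [quad] becomes
    even in w after the substitution t = (1 - w)/864. *)
Lemma quad_affine (R : comNzRingType) (u : R) : 864 * u = 1 ->
  quad R \Po (u *: (1 - 'X)) = ((432 * u ^+ 2) *: (1 - 'X)) \Po 'X^2.
Proof.
move=> uE; have uPE : 864 * u%:P = 1 by rewrite -polyC_natr -polyCM uE.
rewrite /quad comp_polyB comp_polyM comp_poly_natr comp_Xn_poly comp_polyX.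
rewrite comp_polyZ comp_polyB comp_poly1 comp_polyX -!mul_polyC.
rewrite polyCM polyC_natr polyC_exp; apply: subr0_eq.
transitivity (u%:P * (1 - 'X) * (1 - 864 * u%:P)); first by ring.
by rewrite uPE subrr mulr0.
Qed.

(** The even part in w of Clausen's identity at w^2 = d. *)
Lemma f32_sum_eq0 (R : comNzRingType) p (u d z : R)
    (G := f21_trunc R p \Po (u *: (1 - 'X))) :
    prime p -> (5 < p)%N -> (p ^ 2)%:R = 0 :> R ->
    864 * u = 1 -> 512 * d = 513 -> (- 96) ^+ 3 * z = 1 ->
    (even_poly G).[d] ^+ 2 = 0 -> (odd_poly G).[d] ^+ 2 = 0 ->
  \sum_(k < p) (f32_coef k)%:R * z ^+ k = 0.
Proof.
move=> p_pr p_gt5 p2R uE dE zE A0 B0; pose V := (432 * u ^+ 2) *: (1 - 'X) : {poly R}.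
have cl : f32_trunc R p \Po V = even_poly G ^+ 2 + odd_poly G ^+ 2 * 'X.
  rewrite -even_poly_square /G -rmorphXn /= -(clausen_mod p_pr p_gt5 p2R).
  by rewrite -comp_polyA (quad_affine uE) comp_polyA even_poly_compX2.
have := congr1 (fun F : {poly R} => F.[d]) cl.
rewrite horner_comp hornerD hornerMX !horner_exp A0 B0 mul0r addr0.
have -> : V.[d] = z.
  transitivity (V.[d] * ((- 96) ^+ 3 * z)); first by rewrite zE mulr1.
  rewrite hornerZ hornerD hornerN hornerC hornerX.
  transitivity ((864 * u) ^+ 2 * (512 * d - 512) * z); first by ring.
  by rewrite uE dE; ring.
by rewrite horner_poly.
Qed.

Lemma Zp_rmorphism (K : comNzRingType) m : (1 < m)%N -> m%:R = 0 :> K ->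
  exists f : {rmorphism 'Z_m -> K}, forall x, f x = (x : nat)%:R.
Proof.
move=> m1 m0; pose f (x : 'Z_m) : K := (x : nat)%:R.
have fmod k : (k %% m)%:R = k%:R :> K.
  by rewrite [in RHS](divn_eq k m) natrD natrM m0 mulr0 add0r.
have fD : nmod_morphism f.
  split=> // x y; rewrite /f /= -natrD -[in RHS]fmod; congr (_ %% _)%:R.
  exact: Zp_cast.
have fM : monoid_morphism f.
  split=> [|x y]; rewrite /f /=.
    by rewrite -[RHS](fmod 1%N); congr (_ %% _)%:R; exact: Zp_cast.
  by rewrite -natrM -[in RHS]fmod; congr (_ %% _)%:R; exact: Zp_cast.
pose fa := GRing.isNmodMorphism.Build _ _ f fD.
pose fm := GRing.isMonoidMorphism.Build _ _ f fM.
pose g : {rmorphism 'Z_m -> K} := HB.pack f fa fm.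
by exists g.
Qed.

(** Elements of Z/p^2 that vanish in a field of characteristic p are multiples
    of p, so their squares are 0. *)
Lemma f32_sum_Zp2 p (z : 'Z_(p ^ 2)) : prime p -> (5 < p)%N ->
    (p %% 19)%N \in nonresidues19 -> (- 96) ^+ 3 * z = 1 ->
  \sum_(k < p) (f32_coef k)%:R * z ^+ k = 0.
Proof.
move=> p_pr p_gt5 p19 zE.
have p2_gt1 : (1 < p ^ 2)%N by rewrite -(exp1n 2) ltn_exp2r //; lia.
have [K [iota _]] := countable_algebraic_closure 'F_p.
have chp : p \in [pchar K] by rewrite (fmorph_pchar iota) pchar_Fp.
have p2K : (p ^ 2)%:R = 0 :> K by rewrite natrX pcharf0 // expr0n.
have p2R : (p ^ 2)%:R = 0 :> 'Z_(p ^ 2) by rewrite pchar_Zp.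
have [phi phiE] := Zp_rmorphism p2_gt1 p2K.
have phi0 (x : 'Z_(p ^ 2)) : phi x = 0 -> x ^+ 2 = 0.
  rewrite phiE => /eqP; rewrite -(dvdn_pcharf chp) => /dvdnP[c cE].
  by rewrite -[x]natr_Zp cE -natrX expnMn natrM p2R mulr0.
have unitR q : prime q -> q != p -> q%:R \is a @GRing.unit 'Z_(p ^ 2).
  move=> q_pr qp; rewrite unitZpE // coprimeXl // prime_coprime // dvdn_prime2 //.
  by rewrite eq_sym.
have u2 : 2%:R \is a @GRing.unit 'Z_(p ^ 2) by rewrite unitR //; apply/eqP; lia.
have u3 : 3%:R \is a @GRing.unit 'Z_(p ^ 2) by rewrite unitR //; apply/eqP; lia.
have u864 : 864%:R \is a @GRing.unit 'Z_(p ^ 2).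
  by rewrite (_ : 864%:R = 2 ^+ 5 * 3 ^+ 3); [rewrite unitrM !unitrX | ring].
have u512 : 512%:R \is a @GRing.unit 'Z_(p ^ 2).
  by rewrite (_ : 512%:R = 2 ^+ 9); [rewrite unitrX | ring].
pose u : 'Z_(p ^ 2) := 864%:R^-1; have uE : 864 * u = 1 by rewrite mulrV.
pose d : 'Z_(p ^ 2) := 513 / 512; have dE : 512 * d = 513 by rewrite mulrC divrK.
pose G := f21_trunc 'Z_(p ^ 2) p \Po (u *: (1 - 'X)).
have pE : p = p./2.*2.+1.
  have [p2|p_odd] := even_prime p_pr; first by move: p_gt5; rewrite p2.
  by rewrite -[LHS](odd_double_half p) p_odd.
have dK : 512 * phi d = 513 by rewrite -(rmorph_nat phi 512) -rmorphM dE rmorph_nat.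
have uK : 864 * phi u = 1 by rewrite -(rmorph_nat phi 864) -rmorphM uE rmorph1.
have [A0 B0] := f21_parts_root chp pE p_gt5 p19 dK uK.
have GE : f21_trunc K p \Po (phi u *: (1 - 'X)) = map_poly phi G.
  by rewrite /G map_comp_affine map_f21_trunc.
rewrite GE -map_even_poly horner_map in A0; rewrite GE -map_odd_poly horner_map in B0.
exact: (f32_sum_eq0 p_pr p_gt5 p2R uE dE zE (phi0 _ A0) (phi0 _ B0)).
Qed.

Lemma dvdz_Zp_int m (M : int) : (1 < m)%N -> M%:~R = 0 :> 'Z_m -> (m %| M)%Z.
Proof.
move=> m1 M0; rewrite dvdzE /=.
have : `|M|%N%:R = 0 :> 'Z_m.
  case: (intP M) M0 => [|n|n] //=.
  by rewrite rmorphN /= => /eqP; rewrite oppr_eq0 => /eqP.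
by move/(congr1 val) => /=; rewrite val_Zp_nat // => /eqP.
Qed.

Lemma intr_term_clear (R : comNzRingType) p k c (z : R) :
    (- 96) ^+ 3 * z = 1 -> (k < p)%N ->
  (c%:R * (- 96) ^+ (3 * (p.-1 - k)))%:~R =
  (- 96) ^+ (3 * p.-1) * (c%:R * z ^+ k).
Proof.
move=> zE ltk; rewrite rmorphM rmorphXn rmorph_nat rmorphN rmorph_nat /=.
have -> : (3 * p.-1 = 3 * (p.-1 - k) + 3 * k)%N by lia.
rewrite mulrCA; congr (_ * _); rewrite exprD -mulrA (exprM _ 3 k) -exprMn zE.
by rewrite expr1n mulr1.
Qed.

Lemma p_integral_frac p (m q : int) : coprime `|q| p -> q != 0 ->
  (m%:~R / q%:~R : rat) \in p_integral p.
Proof.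
move=> cop q0; rewrite inE /=; set x := _ / _.
have E : numq x * q = m * denq x.
  have qx : x * q%:~R = m%:~R by rewrite /x divfK // intr_eq0.
  apply: (@intr_inj rat); by rewrite !rmorphM /= numqE -qx mulrAC.
have dv : (denq x %| q)%Z.
  rewrite -(@Gauss_dvdzr (denq x) (numq x)) ?E ?dvdz_mull //.
  rewrite /coprimez /gcdz gcdnC; have := coprime_num_den x.
  by rewrite /coprime => /eqP->.
apply: coprime_dvdl cop; exact: dv.
Qed.

Theorem theorem3p5 (p : nat) (hp : prime p) (hp3 : (3 < p)%N)
    (hj : jacobi p%:Z 19 = -1) :
  p_congr p 2
    (\sum_(0 <= k < p)
       ('C(2 * k, k) * 'C(3 * k, k) * 'C(6 * k, 3 * k))%:R
         / (-96%:R : rat) ^+ (3 * k))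
    0.
Proof.
have p19 := jacobi19_nonresidue hj.
have p_gt5 : (5 < p)%N.
  by move: p19 hp hp3; case: p {hj} => [|[|[|[|[|[|p]]]]]].
have p_gt0 := prime_gt0 hp.
have p2_gt1 : (1 < p ^ 2)%N by rewrite -(exp1n 2) ltn_exp2r //; lia.
pose M : int := \sum_(k < p) (f32_coef k)%:R * (- 96) ^+ (3 * (p.-1 - k)).
pose q : int := (- 96) ^+ (3 * p.-1).
have cop96 : coprime 96 p.
  rewrite coprime_sym prime_coprime // (_ : 96 = 2 ^ 5 * 3)%N //.
  by rewrite Euclid_dvdM // Euclid_dvdX // !dvdn_prime2 //; lia.
have q0 : q != 0 by rewrite expf_neq0.
have copq : coprime `|q| p by rewrite abszX coprimeXl.
have sumE : \sum_(0 <= k < p) ('C(2 * k, k) * 'C(3 * k, k) * 'C(6 * k, 3 * k))%:R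
    / (-96%:R : rat) ^+ (3 * k) = M%:~R / q%:~R.
  rewrite big_mkord rmorph_sum mulr_suml; apply: eq_bigr => k _ /=.
  rewrite intrM (rmorph_nat (@intmul rat 1)) !(rmorphXn (@intmul rat 1)) /=.
  rewrite (_ : (- 96)%:~R = - 96%:R :> rat) // -mulrA; congr (_ * _).
  have -> : (3 * p.-1 = 3 * (p.-1 - k) + 3 * k)%N by have := ltn_ord k; lia.
  rewrite exprD invfM mulrA divff ?mul1r //; exact: expf_neq0.
have M2 : ((p ^ 2)%N %| M)%Z.
  apply: (@dvdz_Zp_int (p ^ 2)) => //.
  have u96 : (96%:R : 'Z_(p ^ 2)) \is a GRing.unit.
    by rewrite unitZpE // coprimeXl // coprime_sym.
  pose z : 'Z_(p ^ 2) := (- 96) ^- 3.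
  have zE : (- 96) ^+ 3 * z = 1 by rewrite mulrV // unitrX // unitrN.
  transitivity ((- 96) ^+ (3 * p.-1) *
      \sum_(k < p) (f32_coef k)%:R * z ^+ k : 'Z_(p ^ 2)).
    rewrite rmorph_sum mulr_sumr; apply: eq_bigr => k _ /=.
    exact: intr_term_clear zE (ltn_ord k).
  by rewrite f32_sum_Zp2 // mulr0.
have /dvdzP[c cE] := M2.
have pp0 : (p%:R ^+ 2 : rat) != 0 by rewrite expf_neq0 // pnatr_eq0 -lt0n.
rewrite /p_congr sumE subr0 p_integral_frac // cE.
have -> : (c * (p ^ 2)%N)%:~R / q%:~R / p%:R ^+ 2 = c%:~R / q%:~R :> rat.
  by rewrite intrM -pmulrn natrX mulrAC mulfK.
by rewrite p_integral_frac // inE /= coprime1n.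
Qed.
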